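(* Let $H$ be a Hilbert module over a $C^*$-algebra. Suppose that $P\in\mathcal{L}(H)$ is a projection and $Q\in\mathcal{L}(H)$ is an idempotent. If one element in $$\Sigma:=\big\{(A,B): A\in \{P, I-P\},\ B\in \{Q,Q^*, I-Q,I-Q^*\}\big\}$$ is a quasi-projection pair, then all the remaining elements in $\Sigma$ are quasi-projection pairs.
   Context: $\mathcal{L}(H)$ is the $C^*$-algebra of adjointable operators on the Hilbert $C^*$-module $H$, and $I$ is the identity operator on $H$. An idempotent is $Q\in\mathcal{L}(H)$ with $Q^2=Q$; a projection is an idempotent $P$ with $P^*=P$. An ordered pair $(P,Q)$, with $P\in\mathcal{L}(H)$ a projection and $Q\in\mathcal{L}(H)$ an idempotent, is called a quasi-projection pair if $PQ^*P=PQP$, $PQ^*(I-P)=-PQ(I-P)$, and $(I-P)Q^*(I-P)=(I-P)Q(I-P)$. *)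

(* Defs.v *)
From HB Require Import structures.
From mathcomp Require Import all_boot all_order all_algebra.
From mathcomp Require Import complex.
From mathcomp Require Import boolp classical_sets reals.
From mathcomp Require Import topology normedtype.

Set Implicit Arguments.
Unset Strict Implicit.
Unset Printing Implicit Defensive.

Import Order.TTheory GRing.Theory Num.Theory.
Import numFieldNormedType.Exports.

Local Open Scope classical_set_scope.
Local Open Scope ring_scope.

Reserved Notation "''L' ( H )" (at level 0, format "''L' ( H )").
Reserved Notation "T ^†" (at level 1, format "T ^†").

(* C*-algebras over the complex numbers R[i], not assumed to be unital; this
   is why the product is not inherited from a MathComp ring structure.
   Completeness is part of the underlying [CompleteNormedModule]. *)
HB.mixin Record isCStarAlgebra (R : realType) A
    of CompleteNormedModule R[i] A := {
  cmul : A -> A -> A;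
  cstar : A -> A;
  cmulA : associative cmul;
  cmulDl : left_distributive cmul +%R;
  cmulDr : right_distributive cmul +%R;
  cmulZl : forall (c : R[i]) a b, cmul (c *: a) b = c *: cmul a b;
  cmulZr : forall (c : R[i]) a b, cmul a (c *: b) = c *: cmul a b;
  cstarK : involutive cstar;
  cstarD : {morph cstar : a b / a + b};
  cstarZ : forall (c : R[i]) a, cstar (c *: a) = (conjc c) *: cstar a;
  cstarM : forall a b, cstar (cmul a b) = cmul (cstar b) (cstar a);
  cnormM : forall a b, `|cmul a b| <= `|a| * `|b|;
  cnorm_star : forall a, `|cmul (cstar a) a| = `|a| ^+ 2
}.

#[short(type="cstarAlgType")]
HB.structure Definition CStarAlgebra (R : realType) :=
  {A of CompleteNormedModule R[i] A & isCStarAlgebra R A}.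

Definition cpositive (R : realType) (A : cstarAlgType R) (a : A) : Prop :=
  exists b : A, a = cmul (cstar b) b.

(* (Right) Hilbert modules over a C*-algebra [A], with an [A]-valued inner
   product linear in its second argument. By [hdot_norm] the norm of the
   underlying complete normed space is x |-> `|<x, x>| ^ (1/2), so that [H] is
   complete for the norm induced by the inner product. *)
HB.mixin Record isHilbertModule (R : realType) (A : cstarAlgType R) H
    of CompleteNormedModule R[i] H := {
  hact : H -> A -> H;
  hdot : H -> H -> A;
  hactDl : forall x y a, hact (x + y) a = hact x a + hact y a;
  hactDr : forall x a b, hact x (a + b) = hact x a + hact x b;
  hactM : forall x a b, hact x (cmul a b) = hact (hact x a) b;
  hactZl : forall (c : R[i]) x a, hact (c *: x) a = c *: hact x a;
  hactZr : forall (c : R[i]) x a, hact x (c *: a) = c *: hact x a;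
  hdotDr : forall x y z, hdot x (y + z) = hdot x y + hdot x z;
  hdotZr : forall (c : R[i]) x y, hdot x (c *: y) = c *: hdot x y;
  hdot_act : forall x y a, hdot x (hact y a) = cmul (hdot x y) a;
  hdot_star : forall x y, cstar (hdot x y) = hdot y x;
  hdot_positive : forall x, cpositive (hdot x x);
  hdot_eq0 : forall x, hdot x x = 0 -> x = 0;
  hdot_norm : forall x, `|x| ^+ 2 = `|hdot x x|
}.

#[short(type="hilbertModType")]
HB.structure Definition HilbertModule (R : realType) (A : cstarAlgType R) :=
  {H of CompleteNormedModule R[i] H & isHilbertModule R A H}.

Section Adjointable.
Context {R : realType} {A : cstarAlgType R} {H : hilbertModType A}.
Implicit Types (x y z : H) (T S : H -> H).

Definition is_adjoint T S : Prop :=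
  forall x y, hdot (T x) y = hdot x (S y) :> A.

Definition adjointable T : Prop := exists S, is_adjoint T S.

Lemma hdot0r x : hdot x 0 = 0 :> A.
Proof. by rewrite -(scale0r (0 : H)) hdotZr scale0r. Qed.

Lemma hdotNr x y : hdot x (- y) = - hdot x y :> A.
Proof. by rewrite -scaleN1r hdotZr scaleN1r. Qed.

Lemma hdotDl x y z : hdot (x + y) z = hdot x z + hdot y z :> A.
Proof. by rewrite -hdot_star hdotDr cstarD !hdot_star. Qed.

Lemma hdot0l x : hdot 0 x = 0 :> A.
Proof. by apply: (addrI (hdot 0 x)); rewrite -hdotDl !addr0. Qed.

Lemma hdotNl x y : hdot (- x) y = - hdot x y :> A.
Proof. by apply: (addrI (hdot x y)); rewrite -hdotDl !subrr hdot0l. Qed.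

Lemma hdot_injr x y : (forall z, hdot z x = hdot z y :> A) -> x = y.
Proof.
move=> xy; apply/subr0_eq/(@hdot_eq0 _ A).
by rewrite hdotDr hdotNr xy subrr.
Qed.

Lemma hdot_injl x y : (forall z, hdot x z = hdot y z :> A) -> x = y.
Proof. by move=> xy; apply: hdot_injr => z; rewrite -hdot_star xy hdot_star. Qed.

Lemma is_adjoint_sym T S : is_adjoint T S -> is_adjoint S T.
Proof. by move=> TS x y; rewrite -hdot_star -TS hdot_star. Qed.

Lemma is_adjoint_uniq T S S' : is_adjoint T S -> is_adjoint T S' -> S = S'.
Proof.
by move=> TS TS'; apply/funext => y; apply: hdot_injr => x; rewrite -TS TS'.
Qed.

Lemma adjointableD T x y : adjointable T -> T (x + y) = T x + T y.
Proof.
by case=> S TS; apply: hdot_injl => z; rewrite hdotDl !TS hdotDl.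
Qed.

Lemma is_adjoint_id : is_adjoint id id. Proof. by []. Qed.

Lemma is_adjoint0 : is_adjoint (fun=> 0) (fun=> 0).
Proof. by move=> x y; rewrite hdot0l hdot0r. Qed.

Lemma is_adjointN T S :
  is_adjoint T S -> is_adjoint (fun x => - T x) (fun x => - S x).
Proof. by move=> TS x y; rewrite hdotNl hdotNr TS. Qed.

Lemma is_adjointD T S T' S' : is_adjoint T S -> is_adjoint T' S' ->
  is_adjoint (fun x => T x + T' x) (fun x => S x + S' x).
Proof. by move=> TS TS' x y; rewrite hdotDl hdotDr TS TS'. Qed.

Lemma is_adjointM T S T' S' : is_adjoint T S -> is_adjoint T' S' ->
  is_adjoint (T \o T') (S' \o S).
Proof. by move=> TS TS' x y; rewrite /= TS TS'. Qed.

End Adjointable.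

(* Adjointability already implies linearity, A-linearity and boundedness. *)
Record adjop (R : realType) (A : cstarAlgType R) (H : hilbertModType A) :=
  Adjop { adjop_fun :> H -> H; _ : `[< adjointable adjop_fun >] }.

HB.instance Definition _ R A H := [isSub for @adjop_fun R A H].
HB.instance Definition _ R A H := [Choice of @adjop R A H by <:].

Notation "''L' ( H )" := (adjop H) : type_scope.

Section AdjopRing.
Context {R : realType} {A : cstarAlgType R} {H : hilbertModType A}.
Implicit Types S T : 'L(H).

Lemma adjopP T : adjointable T.
Proof. by apply/asboolP; case: T. Qed.

Lemma adjop_eq S T : S =1 T -> S = T.
Proof. by move=> ST; apply/val_inj/funext. Qed.

Definition adjop_of (T S : H -> H) (TS : is_adjoint T S) : 'L(H) :=
  Adjop (asboolT (ex_intro _ S TS)).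

Definition adj_fun T : H -> H := projT1 (cid (adjopP T)).

Lemma adj_funP T : is_adjoint T (adj_fun T).
Proof. exact: projT2 (cid (adjopP T)). Qed.

Definition adj T : 'L(H) := adjop_of (is_adjoint_sym (adj_funP T)).

Definition adjop0 : 'L(H) := adjop_of is_adjoint0.
Definition adjop1 : 'L(H) := adjop_of is_adjoint_id.
Definition adjopN T : 'L(H) := adjop_of (is_adjointN (adj_funP T)).
Definition adjopD S T : 'L(H) :=
  adjop_of (is_adjointD (adj_funP S) (adj_funP T)).
Definition adjopM S T : 'L(H) :=
  adjop_of (is_adjointM (adj_funP S) (adj_funP T)).

Fact adjop_addA : associative adjopD.
Proof. by move=> S T U; apply: adjop_eq => x /=; rewrite addrA. Qed.
Fact adjop_addC : commutative adjopD.
Proof. by move=> S T; apply: adjop_eq => x /=; rewrite addrC. Qed.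
Fact adjop_add0 : left_id adjop0 adjopD.
Proof. by move=> T; apply: adjop_eq => x /=; rewrite add0r. Qed.
Fact adjop_addN : left_inverse adjop0 adjopN adjopD.
Proof. by move=> T; apply: adjop_eq => x /=; rewrite addNr. Qed.

HB.instance Definition _ := GRing.isZmodule.Build 'L(H)
  adjop_addA adjop_addC adjop_add0 adjop_addN.

Fact adjop_mulA : associative adjopM.
Proof. by move=> S T U; apply: adjop_eq. Qed.
Fact adjop_mul1 : left_id adjop1 adjopM.
Proof. by move=> T; apply: adjop_eq. Qed.
Fact adjop_mulr1 : right_id adjop1 adjopM.
Proof. by move=> T; apply: adjop_eq. Qed.
Fact adjop_mulDl : left_distributive adjopM +%R.
Proof. by move=> S T U; apply: adjop_eq. Qed.
Fact adjop_mulDr : right_distributive adjopM +%R.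
Proof.
by move=> S T U; apply: adjop_eq => x /=; apply: adjointableD (adjopP S).
Qed.

(* Possibly trivial ring, since [H] may be 0. *)
HB.instance Definition _ := GRing.Zmodule_isPzRing.Build 'L(H)
  adjop_mulA adjop_mul1 adjop_mulr1 adjop_mulDl adjop_mulDr.

Lemma adjP T x y : hdot (T x) y = hdot x (adj T y) :> A.
Proof. exact: adj_funP. Qed.

Lemma adjop1E x : (1 : 'L(H)) x = x. Proof. by []. Qed.
Lemma adjopBE S T x : (S - T) x = S x - T x. Proof. by []. Qed.
Lemma adjopME S T x : (S * T) x = S (T x). Proof. by []. Qed.

End AdjopRing.

Notation "T ^†" := (adj T) : ring_scope.

Section QuasiProjection.
Context {R : realType} {A : cstarAlgType R} {H : hilbertModType A}.
Implicit Types P Q : 'L(H).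

Definition is_idempotent Q : Prop := Q * Q = Q.

Definition is_projection P : Prop := is_idempotent P /\ P^† = P.

Definition quasi_projection_pair (PQ : 'L(H) * 'L(H)) : Prop :=
  let: (P, Q) := PQ in
  [/\ is_projection P,
      is_idempotent Q,
      P * Q^† * P = P * Q * P,
      P * Q^† * (1 - P) = - (P * Q * (1 - P)) &
      (1 - P) * Q^† * (1 - P) = (1 - P) * Q * (1 - P)].

Definition Sigma P Q : set ('L(H) * 'L(H)) :=
  [set P; 1 - P] `*` [set Q; Q^†; 1 - Q; 1 - Q^†].

End QuasiProjection.

(* Main.v *)
(* The adjoint turns the off-diagonal identity of a quasi-projection pair
   [(P, Q)] into the one with [P] and [1 - P] exchanged, so the condition is
   invariant under [P |-> 1 - P]; it is visibly invariant under the
   involutions [Q |-> Q^†] and [Q |-> 1 - Q], and these three involutions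
   connect all the pairs of [Sigma P Q]. *)
Require Import Defs.
From mathcomp Require Import all_boot all_order all_algebra.
From mathcomp Require Import complex boolp classical_sets reals.
From mathcomp Require Import topology normedtype.

Import GRing.Theory.
Local Open Scope classical_set_scope.
Local Open Scope ring_scope.

Section QuasiProjectionPairs.
Context {R : realType} {A : cstarAlgType R} {H : hilbertModType A}.
Implicit Types P Q S T : 'L(H).

(** [adj] is built from a chosen witness, so it does not compute. Nondegeneracy of the inner product
    makes the choice immaterial, and each rule for [adj] below follows by exhibiting an adjoint. *)
Lemma adj_unique S T : is_adjoint S T -> S^† = T.
Proof.
by move=> ST; apply/adjop_eq => y; apply: hdot_injr => x; rewrite -adjP ST.
Qed.

Lemma adjK T : T^†^† = T.
Proof. exact/adj_unique/is_adjoint_sym/adjP. Qed.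

Lemma adj1 : (1 : 'L(H))^† = 1.
Proof. exact: adj_unique. Qed.

Lemma adjM S T : (S * T)^† = T^† * S^†.
Proof. exact/adj_unique/(is_adjointM (adjP S) (adjP T)). Qed.

Lemma adjN T : (- T)^† = - T^†.
Proof. exact/adj_unique/(is_adjointN (adjP T)). Qed.

Lemma adjB S T : (S - T)^† = S^† - T^†.
Proof. exact/adj_unique/(is_adjointD (adjP S) (is_adjointN (adjP T))). Qed.

Lemma is_idempotentC Q : is_idempotent Q -> is_idempotent (1 - Q).
Proof.
by rewrite /is_idempotent => QQ; rewrite mulrBl mul1r mulrBr mulr1 QQ subrr subr0.
Qed.

Lemma is_idempotent_adj Q : is_idempotent Q -> is_idempotent Q^†.
Proof. by rewrite /is_idempotent => QQ; rewrite -adjM QQ. Qed.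

Lemma is_projectionC P : is_projection P -> is_projection (1 - P).
Proof. by case=> PP Pa; split; [exact: is_idempotentC | rewrite adjB adj1 Pa]. Qed.

Lemma quasi_projection_pairCl P Q :
  quasi_projection_pair (1 - P, Q) <-> quasi_projection_pair (P, Q).
Proof.
(* One direction for arbitrary [P0] suffices: its instance at [1 - P] is the converse, as
   complementation is an involution. *)
have imp P0 : quasi_projection_pair (P0, Q) -> quasi_projection_pair (1 - P0, Q).
  case=> hP hQ e1 e2 e3; rewrite /quasi_projection_pair subKr.
  split=> //; first exact: is_projectionC.
  have [[_ Pa] [_ Ca]] := (hP, is_projectionC _ hP).
  (* Adjoining [e2] gives the off-diagonal identity for [1 - P0]; the diagonal ones, [e1] and [e3],
     just trade places. *)
  have := congr1 adj e2; rewrite adjN !adjM adjK Pa Ca !mulrA => ->.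
  by rewrite opprK.
by split=> [/imp|]; [rewrite subKr | apply: imp].
Qed.

Lemma quasi_projection_pair_adjr P Q :
  quasi_projection_pair (P, Q^†) <-> quasi_projection_pair (P, Q).
Proof.
have imp Q0 : quasi_projection_pair (P, Q0) -> quasi_projection_pair (P, Q0^†).
  case=> hP hQ e1 e2 e3; rewrite /quasi_projection_pair adjK.
  by split=> //; [exact: is_idempotent_adj | rewrite e2 opprK].
by split=> [/imp|]; [rewrite adjK | apply: imp].
Qed.

Lemma quasi_projection_pairCr P Q :
  quasi_projection_pair (P, 1 - Q) <-> quasi_projection_pair (P, Q).
Proof.
have imp Q0 : quasi_projection_pair (P, Q0) -> quasi_projection_pair (P, 1 - Q0).
  case=> hP hQ e1 e2 e3; rewrite /quasi_projection_pair adjB adj1.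
  have corner S T B : S * (1 - B) * T = S * T - S * B * T.
    by rewrite mulrBr mulr1 mulrBl.
  (* On the diagonal, [S * T] is the same on both sides. The off-diagonal identity has a sign, so
     there this term has to vanish. *)
  have PC : P * (1 - P) = 0 by rewrite mulrBr mulr1 hP.1 subrr.
  rewrite !corner e1 e2 e3 PC.
  by split=> //; [exact: is_idempotentC | rewrite !sub0r].
by split=> [/imp|]; [rewrite subKr | apply: imp].
Qed.

(** Comparing every pair with the base pair [(P, Q)] avoids comparing the members of [Sigma P Q] two
    by two. *)
Lemma quasi_projection_pair_Sigma P Q AB : Sigma P Q AB ->
  quasi_projection_pair AB <-> quasi_projection_pair (P, Q).
Proof.
case: AB => S T [hS hT].
apply: (@iff_trans _ (quasi_projection_pair (P, T))).
  by case: hS => /= ->; [|exact: quasi_projection_pairCl].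
case: hT => [[[|]|]|] /= ->.
- by [].
- exact: quasi_projection_pair_adjr.
- exact: quasi_projection_pairCr.
- exact: iff_trans (quasi_projection_pairCr _ _) (quasi_projection_pair_adjr _ _).
Qed.

End QuasiProjectionPairs.

Theorem theorem2p4 (R : realType) (A : cstarAlgType R) (H : hilbertModType A)
    (P Q : 'L(H)) (hP : is_projection P) (hQ : is_idempotent Q) :
  (exists AB, Sigma P Q AB /\ quasi_projection_pair AB) ->
  forall AB, Sigma P Q AB -> quasi_projection_pair AB.
Proof.
move=> [AB [/quasi_projection_pair_Sigma ABE /ABE qPQ]] CD.
by move=> /quasi_projection_pair_Sigma ->.
Qed.
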